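(* Let $R=\mathrm{GR}(p^m,r)[u]/\langle g(u),p^{m-1}u^t\rangle$ be a finite chain ring, let $a(x),b(x)\in B_T$ be such that $a(x)\sim_{n,T}b(x)$, and let $\alpha\in T^*$ be such that $\phi: f(x)\mapsto f(\alpha x)$ is an associated isomorphism $R[x]/\langle x^n-a(x)\rangle\to R[x]/\langle x^n-b(x)\rangle$. Let $C$ be a $\mathrm{GR}(p^m,r)$-linear $(x^n-a(x))$-polycyclic code of length $n$ over $R$. Then $\phi(C)$ is a $\mathrm{GR}(p^m,r)$-linear $(x^n-b(x))$-polycyclic code of length $n$ over $R$, and $C$ and $\phi(C)$ are monomially equivalent.
   Context: $\mathrm{GR}(p^m,r)$ is the Galois ring of characteristic $p^m$ and rank $r$. Every finite chain ring (finite commutative local ring whose ideals form a chain) of characteristic $p^m$ with residue field $\mathbb F_{p^r}$ is of the form $R=\mathrm{GR}(p^m,r)[u]/\langle g(u),p^{m-1}u^t\rangle$ with $g$ an Eisenstein polynomial over $\mathrm{GR}(p^m,r)$; $\mathrm{GR}(p^m,r)$ is viewed as a subring of $R$. $T^*$ is the unique cyclic subgroup of $R^\times$ of order $p^r-1$ (the nonzero elements of the Teichmüller set $T=T^*\cup\{0\}$); it is contained in $\mathrm{GR}(p^m,r)^\times$. For $n\ge 2$, $B_T$ is the set of binomials $b_1x^k+b_0$ with $0<k<n$ and $b_1,b_0\in T^*$. For $a(x),b(x)\in B_T$, $a(x)\sim_{n,T}b(x)$ ($(n,T)$-equivalent) means there exists $\alpha\in T^*$ such that $f(x)\mapsto f(\alpha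 x)$ is a (well-defined) $R$-algebra isomorphism $R[x]/\langle x^n-a(x)\rangle\to R[x]/\langle x^n-b(x)\rangle$. Let $S$ be a subring of $R$. An $S$-linear code of length $n$ over $R$ is an $S$-submodule of $R^n$; $R^n$ is identified with $R[x]/\langle x^n-a(x)\rangle$ via $(c_0,\dots,c_{n-1})\mapsto\sum c_ix^i$. For $a(x)=\sum_{i<n}a_ix^i\in S[x]$, an $S$-linear code $C$ is $(x^n-a(x))$-polycyclic if for every $(c_0,\dots,c_{n-1})\in C$ one has $(0,c_0,\dots,c_{n-2})+c_{n-1}(a_0,\dots,a_{n-1})\in C$; equivalently, $C$ is an $S[x]$-submodule of $R[x]/\langle x^n-a(x)\rangle$. A monomial transformation of $R^n$ is an $S$-linear automorphism of the form $\tau(c_0,\dots,c_{n-1})=(\psi_0(c_{\sigma(0)}),\dots,\psi_{n-1}(c_{\sigma(n-1)}))$ with $\sigma$ a permutation of $\{0,\dots,n-1\}$ and each $\psi_i$ an $S$-module automorphism of $R$. Two $S$-linear codes $C_1,C_2\subset R^n$ are monomially equivalent if $C_1=\tau(C_2)$ for some monomial transformation $\tau$. Here $S=\mathrm{GR}(p^m,r)$. *)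

(* Defs.v *)
From HB Require Import structures.
From mathcomp Require Import all_boot all_order all_algebra all_fingroup all_solvable.
From mathcomp Require Import qpoly ring_quotient generic_quotient boolp.

Set Implicit Arguments.
Unset Strict Implicit.
Unset Printing Implicit Defensive.

Import GRing.Theory.
Local Open Scope ring_scope.
Local Open Scope quotient_scope.

(* Presentation of GR(p^m, r) as (Z/p^m)[x]/(h), h a monic basic irreducible
   polynomial of degree r; the isomorphism type does not depend on h. *)
Record galois_ring_pres (p m r : nat) := GaloisRingPres {
  gr_poly : {poly 'Z_(p ^ m)};
  gr_prime : prime p;
  gr_exp_gt0 : (0 < m)%N;
  gr_monic : gr_poly \is monic;
  gr_size : size gr_poly = r.+1;
  gr_irr : irreducible_poly
             (map_poly (fun c : 'Z_(p ^ m) => (c : nat)%:R : 'F_p) gr_poly)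
}.

Definition galois_ring (p m r : nat) (G : galois_ring_pres p m r) : Type :=
  {poly %/ gr_poly G}.

HB.instance Definition _ p m r (G : galois_ring_pres p m r) :=
  GRing.ComNzRing.copy (galois_ring G) {poly %/ gr_poly G}.
HB.instance Definition _ p m r (G : galois_ring_pres p m r) :=
  Finite.copy (galois_ring G)
    {poly_(size (mk_monic (gr_poly G))).-1 'Z_(p ^ m)}.

(* The condition on the constant term is p * unit rather than "not in (p^2)" so
   that u^e is Eisenstein when p = 0 in S, i.e. over GR(p, r) = F_(p^r). *)
Definition eisenstein (p : nat) (S : comNzRingType) (g : {poly S}) : Prop :=
  [/\ g \is monic, (1 < size g)%N,
      forall i, (i < (size g).-1)%N -> exists c : S, g`_i = p%:R * c
    & exists c d : S, d * c = 1 /\ g`_0 = p%:R * c].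

(* With t = 0 the characteristic would be p^(m-1); every t > 0 gives a
   finite chain ring of characteristic p^m and residue field F_(p^r). *)
Record chain_ring_pres (p m r : nat) (G : galois_ring_pres p m r) :=
  ChainRingPres {
    cr_poly : {poly galois_ring G};
    cr_exp : nat;
    cr_eisenstein : eisenstein p cr_poly;
    cr_exp_gt0 : (0 < cr_exp)%N
  }.

Section ChainRing.
Variables (p m r : nat) (G : galois_ring_pres p m r) (D : chain_ring_pres G).

Local Notation S := (galois_ring G).
Local Notation g := (cr_poly D).
Local Notation t := (cr_exp D).

Definition chain_ideal : {pred {poly S}} := fun f =>
  `[< exists q1 q2 : {poly S},
        f = q1 * g + q2 * ((p ^ m.-1)%:R *: 'X^t) >].

Lemma galois_ring_natr0 : (p ^ m)%:R = 0 :> S.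
Proof.
have pm1 : (1 < p ^ m)%N.
  by rewrite -(expn0 p) ltn_exp2l ?(gr_exp_gt0 G) // prime_gt1 ?(gr_prime G).
apply: val_inj; rewrite /= (qpolyC_natr (gr_poly G)) -polyC_natr.
by rewrite pchar_Zp.
Qed.

Lemma chain_ideal_closed : idealr_closed chain_ideal.
Proof.
split.
- by apply/asboolP; exists 0, 0; rewrite !mul0r addr0.
- apply/asboolP => -[q1 [q2 e]].
  have [_ _ _ [c [d [_ g0]]]] := cr_eisenstein D.
  have /(congr1 (horner_eval (0 : S))) := e.
  rewrite rmorph1 rmorphD !rmorphM /= /horner_eval hornerZ hornerXn expr0n.
  rewrite -[t]prednK ?(cr_exp_gt0 D) //= !mulr0 addr0 [g.[0]]horner_coef0 g0.
  move=> /esym pu.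
  have : (1 : S) = 0.
    rewrite -(expr1n S m) -pu mulrCA exprMn -natrX galois_ring_natr0.
    by rewrite mul0r.
  by move/eqP; rewrite oner_eq0.
- move=> a u v /asboolP[u1 [u2 ->]] /asboolP[v1 [v2 ->]].
  apply/asboolP; exists (a * u1 + v1), (a * u2 + v2).
  by rewrite mulrDr !mulrDl !mulrA addrACA.
Qed.

HB.instance Definition _ := isIdealr.Build {poly S} chain_ideal chain_ideal_closed.

Definition chain_ring : Type := {ideal_quot chain_ideal}.

HB.instance Definition _ := GRing.ComNzRing.copy chain_ring {ideal_quot chain_ideal}.

Definition chain_proj (f : {poly S}) : chain_ring := \pi_{ideal_quot chain_ideal} f.

HB.instance Definition _ :=
  GRing.RMorphism.copy chain_proj (\pi_{ideal_quot chain_ideal}).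

(* Finiteness: every class has a representative reduced modulo the monic g. *)
Definition chain_reduced (x : chain_ring) : {poly %/ g} :=
  in_qpoly g (repr (x : {ideal_quot chain_ideal})).

Definition chain_of_reduced (f : {poly %/ g}) : chain_ring := chain_proj f.

Lemma chain_reducedK : cancel chain_reduced chain_of_reduced.
Proof.
move=> x; rewrite /chain_of_reduced /chain_reduced /chain_proj.
rewrite -[RHS](reprK (x : {ideal_quot chain_ideal})).
apply/eqP; rewrite -Quotient.idealrBE; apply/asboolP.
have [mg sg _ _] := cr_eisenstein D.
set f := repr _; exists (- Pdiv.Ring.rdivp f g), 0.
rewrite mul0r addr0 /= /mk_monic sg mg /=.
rewrite [X in _ - X](Pdiv.RingMonic.rdivp_eq mg f).
by rewrite opprD addrCA subrr addr0 mulNr.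
Qed.

HB.instance Definition _ := Countable.copy chain_ring (can_type chain_reducedK).
HB.instance Definition _ : isFinite chain_ring :=
  CanIsFinite chain_reducedK.
HB.instance Definition _ := FinRing.isNzRing.Build chain_ring.

Definition galois_subring : {pred chain_ring} :=
  fun x => [exists s : S, x == chain_proj s%:P].

End ChainRing.

Section Codes.
Variables (R : finComUnitRingType) (S : {pred R}) (T : {set {unit R}}) (n : nat).

Definition binomial_over (a : {poly R}) : Prop :=
  exists (k : nat) (b1 b0 : {unit R}),
    [/\ (0 < k < n)%N, b1 \in T, b0 \in T
      & a = val b1 *: 'X^k + (val b0)%:P].

Definition scaling_iso (a b : {poly R}) (alpha : {unit R})
    (phi : {lrmorphism {poly %/ 'X^n - a} -> {poly %/ 'X^n - b}}) : Prop :=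
  bijective phi /\
  forall f : {poly R},
    phi (in_qpoly ('X^n - a) f) = in_qpoly ('X^n - b) (f \Po (val alpha *: 'X)).

Definition nT_equivalent (a b : {poly R}) : Prop :=
  exists2 alpha : {unit R}, alpha \in T &
    exists phi : {lrmorphism {poly %/ 'X^n - a} -> {poly %/ 'X^n - b}},
      scaling_iso alpha phi.

Definition linear_code (C : {set 'rV[R]_n}) : Prop :=
  [/\ 0 \in C,
      forall c d : 'rV[R]_n, c \in C -> d \in C -> c + d \in C
    & forall (s : R) (c : 'rV[R]_n), s \in S -> c \in C -> s *: c \in C].

(* (0, c_0, .., c_(n-2)) + c_(n-1) (a_0, .., a_(n-1)); [(rVpoly c)`_j] is c_j. *)
Definition polycyclic_shift (a : {poly R}) (c : 'rV[R]_n) : 'rV[R]_n :=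
  \row_(i < n) ((if (i : nat) is j.+1 then (rVpoly c)`_j else 0)
                + (rVpoly c)`_(n.-1) * a`_i).

Definition polycyclic_code (a : {poly R}) (C : {set 'rV[R]_n}) : Prop :=
  [/\ (size a <= n)%N, a \is a polyOver S, linear_code C
    & forall c : 'rV[R]_n, c \in C -> polycyclic_shift a c \in C].

(* The image of a code under a map of quotients, R^n being identified with
   R[x]/(x^n - a) and R[x]/(x^n - b) through c |-> sum_i c_i x^i. *)
Definition code_image (a b : {poly R})
    (phi : {poly %/ 'X^n - a} -> {poly %/ 'X^n - b}) (C : {set 'rV[R]_n}) :
    {set 'rV[R]_n} :=
  [set poly_rV (phi (in_qpoly ('X^n - a) (rVpoly c)) : {poly R}) | c in C].

Definition sub_linear_automorphism (V : lmodType R) (f : V -> V) : Prop :=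
  [/\ forall x y : V, f (x + y) = f x + f y,
      forall (s : R) (x : V), s \in S -> f (s *: x) = s *: f x
    & bijective f].

Definition monomial_transformation (tau : 'rV[R]_n -> 'rV[R]_n) : Prop :=
  sub_linear_automorphism tau /\
  exists (sigma : 'S_n) (psi : 'I_n -> R^o -> R^o),
    (forall i, sub_linear_automorphism (psi i)) /\
    forall c : 'rV[R]_n, tau c = \row_(i < n) psi i (c 0 (sigma i)).

Definition monomially_equivalent (C1 C2 : {set 'rV[R]_n}) : Prop :=
  exists2 tau : 'rV[R]_n -> 'rV[R]_n,
    monomial_transformation tau & C1 = tau @: C2.

End Codes.

(* Main.v *)
(* In coordinates [phi] is the diagonal map [c_i |-> alpha^i c_i], which is
   monomial; comparing [phi x^n] with [phi a] gives
   [alpha^n b_i = alpha^i a_i], so [phi] intertwines the two polycyclic shifts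
   up to the factor [alpha^-1].  Everything stays GR(p^m, r)-linear because
   [alpha] lies in GR(p^m, r): write [alpha = s + u y] with [s] in GR(p^m, r);
   as [u] and [p] are nilpotent, [alpha = alpha^(p^(r N)) = s^(p^(r N))] for
   large [N]. *)
Require Import Defs.
From HB Require Import structures.
From mathcomp Require Import all_boot all_order all_algebra all_fingroup all_solvable.
From mathcomp Require Import qpoly.

Set Implicit Arguments.
Unset Strict Implicit.
Unset Printing Implicit Defensive.

Import GRing.Theory.
Local Open Scope ring_scope.

(** * Prime-power powers and nilpotent perturbations *)

(** For [i <= p ^ N], [i * 'C(p ^ N, i) = p ^ N * 'C((p ^ N).-1, i.-1)], so the coefficient has
    p-adic valuation at least [N - logn p i], and [logn p i < i]. *)
Lemma dvdn_bin_primepow p m N i : prime p -> (0 < i)%N -> (m + i <= N)%N ->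
  (p ^ m %| 'C(p ^ N, i))%N.
Proof.
case: i => // i p_pr _ leN.
have [lt_i | /bin_small-> //] := leqP i.+1 (p ^ N).
have pN_gt0 : (0 < p ^ N)%N by rewrite expn_gt0 prime_gt0.
rewrite pfactor_dvdn ?bin_gt0 //.
have := mul_bin_diag (p ^ N) i => /(congr1 (logn p)).
rewrite !lognM ?bin_gt0 //; last by rewrite -ltnS prednK.
rewrite pfactorK // => e; rewrite -(leq_add2l (logn p i.+1)) -e.
apply: leq_trans (leq_addr _ _); apply: leq_trans leN.
by rewrite addnC leq_add2l ltnW ?ltn_logl.
Qed.

(** In the binomial expansion, the terms in [y ^+ i] with [0 < i < k] vanish because [p ^ m] divides
    their coefficient, those with [k <= i] because [y ^+ k = 0]. *)
Lemma exprDn_primepow_nilp (R : comPzRingType) p m k N (x y : R) :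
    prime p -> (p ^ m)%:R = 0 :> R -> y ^+ k = 0 -> (m + k <= N)%N ->
  (x + y) ^+ (p ^ N) = x ^+ (p ^ N).
Proof.
move=> p_pr pm0 yk0 leN; rewrite exprDn big_ord_recl subn0 expr0 mulr1 bin0.
rewrite big1 ?addr0 // => i _; rewrite lift0.
have [lt_ik | le_ki] := ltnP i.+1 k.
  have le_mi : (m + i.+1 <= N)%N by apply: leq_trans leN; rewrite leq_add2l ltnW.
  have /dvdnP[q ->] := dvdn_bin_primepow p_pr (ltn0Sn i) le_mi.
  by rewrite -mulr_natr natrM pm0 !mulr0.
by rewrite -(subnKC le_ki) exprD yk0 mul0r mulr0 mul0rn.
Qed.

(** * Nilpotency of u and Teichmüller elements of the chain ring *)

Section ChainRing.
Variables (p m r : nat) (G : galois_ring_pres p m r) (D : chain_ring_pres G).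

Lemma galois_subring_semiring_closed :
  semiring_closed (galois_subring (D := D)).
Proof.
split; split.
- by apply/existsP; exists 0; rewrite polyC0 rmorph0.
- move=> x y /existsP[s /eqP->] /existsP[t /eqP->].
  by apply/existsP; exists (s + t); rewrite polyCD rmorphD.
- by apply/existsP; exists 1; rewrite polyC1 rmorph1.
- move=> x y /existsP[s /eqP->] /existsP[t /eqP->].
  by apply/existsP; exists (s * t); rewrite polyCM rmorphM.
Qed.

HB.instance Definition _ := GRing.isSemiringClosed.Build (chain_ring D)
  (galois_subring (D := D)) galois_subring_semiring_closed.

Lemma chain_ring_natr0 : (p ^ m)%:R = 0 :> chain_ring D.
Proof.
by rewrite -(rmorph_nat (chain_proj D)) -polyC_natr galois_ring_natr0 rmorph0.
Qed.

Lemma chain_proj_cr_poly : chain_proj D (cr_poly D) = 0.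
Proof.
rewrite -(rmorph0 (chain_proj D)); apply/eqP.
rewrite /chain_proj -Quotient.idealrBE subr0; apply/boolp.asboolP.
by exists 1, 0; rewrite mul1r mul0r addr0.
Qed.

(** The Eisenstein relation reads [u ^+ e = - p * h(u)] with [e] the degree of g, so the power
    [e * m] of u is a multiple of [p ^ m = 0]. *)
Lemma chain_projX_nilp : exists k, chain_proj D 'X ^+ k = 0.
Proof.
have [g_mon _ g_eis _] := cr_eisenstein D.
set e := (size (cr_poly D)).-1 in g_eis.
have gE (i : 'I_e) : exists c, (cr_poly D)`_i = p%:R * c.
  exact: g_eis (ltn_ord i).
have [c {}gE] := fin_all_exists gE.
pose h := \sum_(i < e) c i *: 'X^i.
have {}gE : cr_poly D = 'X^e + p%:R * h.
  rewrite -[LHS]coefK poly_def (polySpred (monic_neq0 g_mon)) big_ord_recr /=.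
  rewrite -[(size _).-1]/e -lead_coefE (monicP g_mon) scale1r addrC.
  congr (_ + _); rewrite mulr_sumr; apply: eq_bigr => i _.
  by rewrite gE -scalerA mulr_natl scaler_nat.
exists (e * m)%N.
have /eqP := chain_proj_cr_poly; rewrite gE rmorphD rmorphXn /= addr_eq0.
move=> /eqP Xe; rewrite exprM Xe -mulN1r rmorphM rmorph_nat exprMn exprMn.
by rewrite -natrX chain_ring_natr0 mul0r mulr0.
Qed.

Lemma teichmuller_galois_subring (x : chain_ring D) :
  (0 < r)%N -> x ^+ (p ^ r) = x -> x \in galois_subring (D := D).
Proof.
move=> r_gt0 xq; have [k Xk0] := chain_projX_nilp.
have xqN N : x ^+ (p ^ (r * N)) = x.
  by elim: N => [|N IH]; rewrite ?muln0 ?expr1 // mulnS expnD exprM xq IH.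
(* Splitting off the constant coefficient of a polynomial representative gives [s]; the remaining
   terms are divisible by u. *)
have [s [y xE]] : exists s y, x = chain_proj D s%:P + chain_proj D 'X * y.
  rewrite -[x]chain_reducedK /chain_of_reduced.
  elim/poly_ind: (chain_reduced x : {poly _}) => [|f c _].
    by exists 0, 0; rewrite polyC0 rmorph0 mulr0 addr0.
  by exists c, (chain_proj D f); rewrite rmorphD rmorphM /= addrC mulrC.
have Xyk0 : (chain_proj D 'X * y) ^+ k = 0 by rewrite exprMn Xk0 mul0r.
(* The exponent [r * (m + k)] is at least [m + k] since [0 < r], so the nilpotent part
   disappears. *)
rewrite -(xqN (m + k)%N) xE.
rewrite (exprDn_primepow_nilp _ (gr_prime G) chain_ring_natr0 Xyk0) //.
  by rewrite rpredX //; apply/existsP; exists s.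
by rewrite leq_pmull.
Qed.

End ChainRing.

(** * The substitution x to alpha x in coordinates *)

Section Scaling.
Variables (R : finComUnitRingType) (n : nat).

Lemma coef_comp_scaleX (p : {poly R}) (c : R) i :
  (p \Po (c *: 'X))`_i = c ^+ i * p`_i.
Proof.
have -> : p \Po (c *: 'X) = \poly_(i < size p) (c ^+ i * p`_i).
  rewrite comp_polyE poly_def; apply: eq_bigr => j _.
  by rewrite exprZn scalerA mulrC.
by rewrite coef_poly; case: ltnP => // /(nth_default 0)->; rewrite mulr0.
Qed.

Lemma size_comp_scaleX (p : {poly R}) (c : R) :
  (size (p \Po (c *: 'X)) <= size p)%N.
Proof.
apply/leq_sizeP => i le_pi.
by rewrite coef_comp_scaleX nth_default ?mulr0.
Qed.

Section Quotient.
Variable a : {poly R}.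
Hypotheses (n_gt0 : (0 < n)%N) (a_small : (size a <= n)%N).

Lemma size_XnB : size ('X^n - a) = n.+1.
Proof. by rewrite size_polyDl size_polyXn // size_polyN ltnS. Qed.

Lemma monic_XnB : 'X^n - a \is monic.
Proof.
rewrite monicE lead_coefDl ?lead_coefXn //.
by rewrite size_polyXn size_polyN ltnS.
Qed.

(** [mk_monic] falls back to ['X] unless its argument is monic and nonconstant; here the modulus is
    the intended one. *)
Lemma mk_monic_XnB : mk_monic ('X^n - a) = 'X^n - a.
Proof. by rewrite /mk_monic size_XnB monic_XnB ltnS n_gt0. Qed.

Lemma in_qpoly_XnB_small (p : {poly R}) : (size p <= n)%N ->
  in_qpoly ('X^n - a) p = p :> {poly R}.
Proof.
by move=> le_pn; apply: in_qpoly_small; rewrite mk_monic_XnB size_XnB ltnS.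
Qed.

Lemma in_qpolyXn : in_qpoly ('X^n - a) 'X^n = in_qpoly ('X^n - a) a.
Proof.
have h0 : in_qpoly ('X^n - a) ('X^n - a) = 0.
  apply: val_inj; rewrite /= mk_monic_XnB.
  exact: Pdiv.RingMonic.rmodpp monic_XnB.
by rewrite -[RHS]add0r -h0 -in_qpolyD subrK.
Qed.

End Quotient.

Variables (a b : {poly R}) (alpha : {unit R}).
Variable phi : {lrmorphism {poly %/ 'X^n - a} -> {poly %/ 'X^n - b}}.
Hypotheses (n_gt0 : (0 < n)%N) (a_small : (size a <= n)%N).
Hypothesis b_small : (size b <= n)%N.
Hypothesis phi_iso : scaling_iso alpha phi.

Let c : R := val alpha.

Lemma scaling_iso_coef i : c ^+ n * b`_i = c ^+ i * a`_i.
Proof.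
have [_ phiE] := phi_iso.
(* In the first quotient [x ^ n = a]; applying [phi] gives [c ^+ n *: b] on one side and [a(c x)] on
   the other. *)
have phiXn := congr1 phi (in_qpolyXn n_gt0 a_small).
rewrite !phiE comp_Xn_poly exprZn in_qpolyZ in_qpolyXn // -in_qpolyZ in phiXn.
(* Both representatives have degree below n, so equality of classes is equality of coefficients. *)
have scale_b_small : (size (c ^+ n *: b) <= n)%N.
  exact: leq_trans (size_scale_leq _ _) b_small.
rewrite -coefZ -coef_comp_scaleX -(in_qpoly_XnB_small n_gt0 b_small scale_b_small).
rewrite phiXn in_qpoly_XnB_small //.
exact: leq_trans (size_comp_scaleX _ _) a_small.
Qed.

(** Coordinate form of [f(x)] to [f(d x)], for any [d] so that inverses have the same shape. *)
Definition scaling_row (d : R) (v : 'rV[R]_n) : 'rV[R]_n :=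
  \row_i (d ^+ i * v 0 i).

Lemma scaling_rowK d e : d * e = 1 -> cancel (scaling_row d) (scaling_row e).
Proof.
move=> de v; apply/rowP => i; rewrite !mxE mulrA -exprMn [e * d]mulrC de.
by rewrite expr1n mul1r.
Qed.

Lemma code_image_scaling (C : {set 'rV[R]_n}) :
  code_image phi C = scaling_row c @: C.
Proof.
have [_ phiE] := phi_iso.
apply: eq_imset => v; apply/rowP => i; rewrite phiE.
rewrite in_qpoly_XnB_small //; last first.
  by apply: leq_trans (size_comp_scaleX _ _) _; rewrite size_poly.
by rewrite !mxE coef_comp_scaleX coef_rVpoly_ord.
Qed.

(** The shift is multiplication by x, and substituting [c x] for x turns that factor into [c x]. *)
Lemma polycyclic_shift_scaling (v : 'rV[R]_n) :
  polycyclic_shift b (scaling_row c v) =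
  c^-1 *: scaling_row c (polycyclic_shift a v).
Proof.
have cU : c \is a GRing.unit by apply: valP.
have coefv j : (rVpoly (scaling_row c v))`_j = c ^+ j * (rVpoly v)`_j.
  by rewrite !coef_rVpoly; case: insubP => [i _ <-|]; rewrite ?mxE ?mulr0.
apply/rowP => i; rewrite !mxE !coefv; apply: (mulrI cU).
rewrite mulVKr // !mulrDr; congr (_ + _).
  by case: (i : nat) => [|j]; rewrite ?coefv ?mulr0 // mulrA exprS.
(* The wrap-around term carries [c * c ^+ n.-1 = c ^+ n], which converts [b_i] into
   [c ^+ i * a_i]. *)
by rewrite !mulrA -exprS prednK // mulrAC scaling_iso_coef mulrAC.
Qed.

(** Diagonal maps are monomial with the identity permutation, and commute with all scalars of [R],
    hence with those in [S]. *)
Lemma monomial_scaling_row (S : {pred R}) d : d \is a GRing.unit ->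
  monomial_transformation S (scaling_row d).
Proof.
move=> dU; split; first split.
- by move=> u v; apply/rowP => i; rewrite !mxE mulrDr.
- by move=> s u _; apply/rowP => i; rewrite !mxE mulrCA.
- exists (scaling_row d^-1); apply: scaling_rowK; rewrite ?mulrV ?mulVr //.
exists 1%g, (fun i x => d ^+ i * x); split=> [i|u].
  have diU : d ^+ i \is a GRing.unit by rewrite unitrX.
  split=> [x y|s x _|]; [exact: mulrDr | exact: mulrCA |].
  by exists (fun x => (d ^+ i)^-1 * x) => x; rewrite ?mulKr ?mulVKr.
by apply/rowP => i; rewrite !mxE perm1.
Qed.

Lemma monomially_equivalent_scaling (S : {pred R}) (C : {set 'rV[R]_n}) :
  monomially_equivalent S C (code_image phi C).
Proof.
have cU : c \is a GRing.unit by apply: valP.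
(* The transformation must carry [phi(C)] back to [C], hence the inverse scaling. *)
exists (scaling_row c^-1); first by apply: monomial_scaling_row; rewrite unitrV.
rewrite code_image_scaling -imset_comp -[LHS]imset_id; apply: eq_imset => v /=.
by rewrite scaling_rowK ?mulrV.
Qed.

Lemma polycyclic_code_scaling (S : semiringClosed R) (C : {set 'rV[R]_n}) :
    c \in S ->
  polycyclic_code S a C -> polycyclic_code S b (code_image phi C).
Proof.
have cU : c \is a GRing.unit by apply: valP.
(* In the finite unit group the inverse of [c] is a power of [c], so closure under products
   suffices. *)
move=> cS; have cVS : c^-1 \in S.
  by rewrite -FinRing.val_unitV invg_expg FinRing.val_unitX rpredX.
move=> [_ /polyOverP aS [C0 CD CZ] Cshift].
rewrite code_image_scaling; split => //.
- apply/polyOverP => i; rewrite -[b`_i](mulKr (unitrX n cU)).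
  by rewrite scaling_iso_coef -exprVn !rpredM ?rpredX.
- split.
  + by apply/imsetP; exists 0 => //; apply/rowP => i; rewrite !mxE mulr0.
  + move=> _ _ /imsetP[u uC ->] /imsetP[v vC ->].
    apply/imsetP; exists (u + v); first exact: CD.
    by apply/rowP => i; rewrite !mxE mulrDr.
  + move=> s _ sS /imsetP[u uC ->]; apply/imsetP; exists (s *: u).
      exact: CZ.
    by apply/rowP => i; rewrite !mxE mulrCA.
- move=> _ /imsetP[v vC ->]; rewrite polycyclic_shift_scaling.
  (* The factor [c^-1] from the intertwining relation lies in [S] and is absorbed by the linearity
     of [C]. *)
  apply/imsetP; exists (c^-1 *: polycyclic_shift a v).
    by apply: CZ => //; apply: Cshift.
  by apply/rowP => i; rewrite !mxE mulrCA.
Qed.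

End Scaling.

(** * The Teichmüller group and the conclusion *)

Lemma teichmuller_group_galois_subring p m r (G : galois_ring_pres p m r)
    (D : chain_ring_pres G) (T : {group {unit (chain_ring D)}}) alpha :
  #|T| = (p ^ r).-1 -> alpha \in T -> val alpha \in galois_subring (D := D).
Proof.
move=> T_card alphaT; apply: teichmuller_galois_subring.
  (* For [r = 0] the prescribed order of [T] would be 0. *)
  rewrite lt0n; apply: contraL (cardG_gt0 T) => /eqP r0.
  by rewrite T_card r0.
rewrite -FinRing.val_unitX -[(p ^ r)%N]prednK; last first.
  by rewrite expn_gt0 prime_gt0 ?(gr_prime G).
(* By Lagrange [alpha] to the order of [T] is 1, so [alpha] is fixed by the power [p ^ r]. *)
by rewrite -T_card expgS expg_cardG // mulg1.
Qed.

Lemma size_binomial_over (R : finComUnitRingType) (T : {set {unit R}}) n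
  (a : {poly R}) : binomial_over T n a -> (size a <= n)%N.
Proof.
case=> k [b1 [b0 [/andP[k_gt0 k_lt] _ _ ->]]].
apply: leq_trans (size_polyD _ _) _; rewrite geq_max; apply/andP; split.
  by apply: leq_trans (size_scale_leq _ _) _; rewrite size_polyXn.
by apply: leq_trans (size_polyC_leq1 _) (ltn_trans k_gt0 k_lt).
Qed.

Theorem proposition14
  (p m r : nat) (G : galois_ring_pres p m r) (D : chain_ring_pres G)
  (n : nat) (n_ge2 : (2 <= n)%N)
  (T : {group {unit (chain_ring D)}})
  (T_cyclic : cyclic T) (T_card : #|T| = (p ^ r).-1)
  (a b : {poly (chain_ring D)})
  (Ba : binomial_over T n a) (Bb : binomial_over T n b)
  (ab_equiv : nT_equivalent T n a b)
  (alpha : {unit (chain_ring D)}) (alphaT : alpha \in T)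
  (phi : {lrmorphism {poly %/ 'X^n - a} -> {poly %/ 'X^n - b}})
  (phi_iso : scaling_iso alpha phi)
  (C : {set 'rV[chain_ring D]_n})
  (C_polycyclic : polycyclic_code (galois_subring (D := D)) a C) :
  polycyclic_code (galois_subring (D := D)) b (code_image phi C) /\
  monomially_equivalent (galois_subring (D := D)) C (code_image phi C).
Proof.
pose proof (n_gt0 := ltnW n_ge2).
pose proof (b_small := size_binomial_over Bb).
pose proof (a_small := size_binomial_over Ba).
pose proof (alphaS := teichmuller_group_galois_subring T_card alphaT).
exact (conj
  (polycyclic_code_scaling n_gt0 a_small b_small phi_iso alphaS C_polycyclic)
  (monomially_equivalent_scaling n_gt0 b_small phi_iso _ C)).
Qed.
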